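(* Let $(\alpha,\beta)\in{}^*\mathbb N^2$ be a Ramsey pair. Then: 1. $\alpha+\beta\not\sim\alpha\cdot\beta$; 2. $\alpha\cdot\beta\not\sim\alpha^\beta$; 3. $\alpha^\beta\not\sim\beta^\alpha$; 4. for every function $f:\mathbb N\to\mathbb N$ and every polynomial $g\in\mathbb Z[x,y]$, $f(\alpha)\cdot 2^\beta\not\sim g(\alpha,\beta)$.
   Context: $\mathbb N$ is the set of positive integers. ${}^*\mathbb N$ is a fixed $\mathfrak c^+$-saturated elementary extension (nonstandard extension) of $\mathbb N$ equipped with its full first-order structure (a symbol for every subset of every $\mathbb N^k$); ${}^*A$ is the nonstandard extension of $A\subseteq\mathbb N^k$, and functions on $\mathbb N^k$ are denoted by the same symbol as their nonstandard extensions. The same applies to $\mathbb Z$ and ${}^*\mathbb Z$. For $\alpha\in{}^*\mathbb N^k$, $\mathfrak u(\alpha)=\{A\subseteq\mathbb N^k\mid\alpha\in{}^*A\}\in\beta\mathbb N^k$ (the space of ultrafilters on $\mathbb N^k$), and $\alpha\sim\alpha'$ means $\mathfrak u(\alpha)=\mathfrak u(\alpha')$ (likewise for tuples from ${}^*\mathbb Z$, using subsets of $\mathbb Z^k$). For $H\subseteq\mathbb N$, $[H]^2=\{(h_1,h_2)\in H^2\mid h_1<h_2\}$. An ultrafilter $u$ on $\mathbb N^2$ is a Ramsey's witness, $u\in\mathrm{RW}$, if for every $A\in u$ there is an infinite $H\subseteq\mathbb N$ with $[H]^2\subseteq A$. A pair $(\alpha,\beta)\in{}^*\mathbb N^2$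 is a Ramsey pair if $\mathfrak u(\alpha,\beta)\in\mathrm{RW}$. *)

(* Defs.v *)
From HB Require Import structures.
From mathcomp Require Import all_boot all_order all_algebra.
From mathcomp Require Import all_classical.

Set Implicit Arguments.
Unset Strict Implicit.
Unset Printing Implicit Defensive.

Local Open Scope classical_set_scope.

Record posnat := Posnat { posnat_val :> nat; posnat_gt0 : (0 < posnat_val)%N }.

HB.instance Definition _ := [isSub for posnat_val].
HB.instance Definition _ := [Countable of posnat by <:].
HB.instance Definition _ := isPointed.Build posnat (Posnat (ltn0Sn 0)).
HB.instance Definition _ := isPointed.Build int 0%R.

Lemma paddn_proof (m n : posnat) : (0 < m + n)%N.
Proof. by rewrite addn_gt0 posnat_gt0. Qed.

Lemma pmuln_proof (m n : posnat) : (0 < m * n)%N.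
Proof. by rewrite muln_gt0 !posnat_gt0. Qed.

Lemma pexpn_proof (m n : posnat) : (0 < m ^ n)%N.
Proof. by rewrite expn_gt0 posnat_gt0. Qed.

Definition paddn (m n : posnat) : posnat := Posnat (paddn_proof m n).
Definition pmuln (m n : posnat) : posnat := Posnat (pmuln_proof m n).
Definition pexpn (m n : posnat) : posnat := Posnat (pexpn_proof m n).
Definition ptwo : posnat := Posnat (ltn0Sn 1).
Definition pint (n : posnat) : int := Posz n.

(* A polynomial in [Z[x,y] = Z[y][x]]: the outer indeterminate is [x]. *)
Definition eval2 (g : {poly {poly int}}) (x y : int) : int :=
  (g.[x%:P].[y])%R.

(* Every subset of every [X^k] is a relation symbol of arity [k]; functions
   enter the language through their graphs.  Variables are natural numbers. *)
Inductive formula (X : Type) : Type :=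
| Rel (k : nat) (A : set (k.-tuple X)) (t : k.-tuple nat)
| Eq (i j : nat)
| Not (phi : formula X)
| And (phi psi : formula X)
| All (i : nat) (phi : formula X).

Arguments Rel {X k}.
Arguments Eq {X}.
Arguments Not {X}.
Arguments And {X}.
Arguments All {X}.

Definition upd (M : Type) (v : nat -> M) (i : nat) (x : M) : nat -> M :=
  fun j => if j == i then x else v j.

(* [I] interprets the relation symbols in [M]; equality is genuine. *)
Fixpoint holds (X M : Type)
    (I : forall k, set (k.-tuple X) -> set (k.-tuple M))
    (v : nat -> M) (phi : formula X) : Prop :=
  match phi with
  | Rel k A t => I k A (map_tuple v t)
  | Eq i j => v i = v j
  | Not phi => ~ holds I v phi
  | And phi psi => holds I v phi /\ holds I v psi
  | All i phi => forall x : M, holds I (upd v i x) phi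
  end.

Definition full_interp (X : Type) (k : nat) (A : set (k.-tuple X)) := A.

Definition elementary_embedding (X M : Type)
    (I : forall k, set (k.-tuple X) -> set (k.-tuple M)) (e : X -> M) : Prop :=
  forall (phi : formula X) (v : nat -> X),
    holds (@full_interp X) v phi <-> holds I (e \o v) phi.

(* [c^+]-saturation: every finitely satisfiable set [p] of formulas in the
   variable 0, with parameters in a set [C] of cardinality at most that of the
   continuum, is realized.  A formula with parameters is a formula together
   with a valuation whose value at 0 is to be overridden; requiring also
   [v 0] to lie in [C] is harmless, as [C] may be enlarged by one point. *)
Definition cplus_saturated (X M : Type)
    (I : forall k, set (k.-tuple X) -> set (k.-tuple M)) : Prop :=
  forall (C : set M) (p : set (formula X * (nat -> M))),
    (C #<= [set: set nat])%card ->
    (forall q, p q -> forall i, C (q.2 i)) ->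
    (forall F, finite_set F -> F `<=` p ->
       exists x, forall q, F q -> holds I (upd q.2 0 x) q.1) ->
    exists x, forall q, p q -> holds I (upd q.2 0 x) q.1.

Record nsext (X : pointedType) := Nsext {
  ns_carrier :> Type;
  star : forall k, set (k.-tuple X) -> set (k.-tuple ns_carrier);
  ns_emb : X -> ns_carrier;
  ns_elementary : elementary_embedding star ns_emb;
  ns_saturated : cplus_saturated star
}.

Arguments star {X} E {k} A : rename.

Lemma holds_alls (X M : Type)
    (I : forall k, set (k.-tuple X) -> set (k.-tuple M))
    (s : seq nat) (phi : formula X) (v : nat -> M) :
  holds I v (foldr All phi s) <->
  (forall w, (forall i, i \notin s -> w i = v i) -> holds I w phi).
Proof.
elim: s v => [|j s IHs] v /=.
  split=> [h w wv|]; last by apply.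
  by suff -> : w = v by []; apply/funext => i; exact: wv.
split=> [h w wv|h x].
- apply: (proj1 (IHs _) (h (w j))) => i i_s; rewrite /upd.
  by case: eqVneq => [->//|ij]; apply: wv; rewrite inE negb_or ij.
- apply/IHs => w wv; apply: h => i; rewrite inE negb_or => /andP[ij i_s].
  by rewrite wv // /upd (negbTE ij).
Qed.

Definition graph (X : Type) (k : nat) (f : k.-tuple X -> X) :
    set (k.+1.-tuple X) :=
  [set t | thead t = f (behead_tuple t)].

Lemma map_nth_iota (T : Type) (d : T) (n : nat) (s : seq T) (v : nat -> T) :
  size s = n -> forall m, (forall i, (i < n)%N -> v (m + i)%N = nth d s i) ->
  map v (iota m n) = s.
Proof.
move=> sn m vE; apply: (@eq_from_nth _ d); first by rewrite size_map size_iota.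
move=> i; rewrite size_map size_iota => i_n.
by rewrite (nth_map 0) ?size_iota // nth_iota // vE.
Qed.

Lemma star_graph_total (X : pointedType) (E : nsext X) (k : nat)
    (f : k.-tuple X -> X) (a : k.-tuple E) :
  exists b : E, star E (graph f) (cons_tuple b a).
Proof.
pose phi : formula X := foldr All
  (Not (All 0 (Not (Rel (graph f) (cons_tuple 0 (iota_tuple k 1)))))) (iota 1 k).
have std : holds (@full_interp X) (fun=> point) phi.
  apply/holds_alls => w _ /= h.
  apply: (h (f (map_tuple w (iota_tuple k 1)))).
  rewrite /full_interp /graph /= /thead (tnth_nth point) /upd /=; congr f.
  apply: val_inj; apply/eq_in_map => i.
  by rewrite mem_iota => /andP[]; case: i.
move: std => /(ns_elementary E)/holds_alls.
pose d := ns_emb E point.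
move=> /(_ (fun i => nth d (d :: a) i)) h.
apply: contrapT => no; apply: h => [i|x /= Hx].
  rewrite mem_iota add1n ltnS negb_and -leqNgt leqn0 -ltnNge.
  case/orP => [/eqP ->//|ki].
  by rewrite nth_default //= size_tuple.
apply: no; exists x; move: Hx.
congr (star E (graph f) _); apply: val_inj => /=; congr cons.
by apply: (@map_nth_iota _ d); rewrite ?size_tuple.
Qed.

Definition star_fun (X : pointedType) (E : nsext X) (k : nat)
    (f : k.-tuple X -> X) (a : k.-tuple E) : E :=
  projT1 (cid (star_graph_total f a)).

Lemma star_graphE (X : pointedType) (E : nsext X) (k : nat)
    (f : k.-tuple X -> X) (a : k.-tuple E) (b : E) :
  star E (graph f) (cons_tuple b a) <-> b = star_fun f a.
Proof.
rewrite /star_fun; case: cid => c /= Hc; split=> [Hb|->//].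
pose phi : formula X := foldr All (Not (And (And
  (Rel (graph f) (cons_tuple 0 (iota_tuple k 1)))
  (Rel (graph f) (cons_tuple k.+1 (iota_tuple k 1)))) (Not (Eq 0 k.+1))))
  (iota 0 k.+2).
have std : holds (@full_interp X) (fun=> point) phi.
  apply/holds_alls => w _ /= [[]].
  rewrite /full_interp /graph /= /thead !(tnth_nth point) /= => -> ->.
  by apply; congr f; apply: val_inj.
move: std => /(ns_elementary E)/holds_alls.
pose d := ns_emb E point.
move=> /(_ (fun i => nth d (b :: rcons a c) i)) h.
apply: contrapT => bc; apply: h => [i|/=].
  rewrite mem_iota add0n -leqNgt => ki.
  by rewrite nth_default //= size_rcons size_tuple.
have ac : nth d (rcons a c) k = c by rewrite nth_rcons size_tuple ltnn eqxx.
have am : map_tuple (fun i => nth d (b :: rcons a c) i) (iota_tuple k 1) = a.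
  apply: val_inj => /=; apply: (@map_nth_iota _ d); rewrite ?size_tuple// => i ik.
  by rewrite /= nth_rcons size_tuple ik.
split; last by rewrite ac.
by split; [move: Hb|move: Hc]; congr (star E (graph f) _);
  apply: val_inj => /=; rewrite ?ac; congr cons; move/(congr1 val): am.
Qed.

Definition star1 (X : pointedType) (E : nsext X) (f : X -> X) (a : E) : E :=
  star_fun (fun t : 1.-tuple X => f (thead t)) [tuple a].

Definition star2 (X : pointedType) (E : nsext X) (f : X -> X -> X) (a b : E) :
    E :=
  star_fun (fun t : 2.-tuple X => f (tnth t ord0) (tnth t ord_max))
    [tuple a; b].

Definition ultra (X : pointedType) (E : nsext X) (k : nat) (a : k.-tuple E) :
    set_system (k.-tuple X) :=
  [set A | star E A a].

(* The relation [~]; a single element is treated as a 1-tuple. *)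
Definition ueq (X : pointedType) (E : nsext X) (k : nat) (a b : k.-tuple E) :
    Prop :=
  ultra a = ultra b.

Definition ueq1 (X : pointedType) (E : nsext X) (a b : E) : Prop :=
  ueq [tuple a] [tuple b].

Definition increasing_pairs (H : set posnat) : set (2.-tuple posnat) :=
  [set t | exists h1 h2 : posnat,
    [/\ H h1, H h2, (h1 < h2)%N & t = [tuple h1; h2]]].

Definition ramsey_witness (u : set_system (2.-tuple posnat)) : Prop :=
  UltraFilter u /\
  forall A, u A -> exists H : set posnat,
    infinite_set H /\ increasing_pairs H `<=` A.

Definition ramsey_pair (E : nsext posnat) (a b : E) : Prop :=
  ramsey_witness (ultra [tuple a; b]).

(* [j] identifies [N] with the subset of [Z] which is the extension of the set
   of positive integers, compatibly with the extensions of all sets. *)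
Record star_inclusion (N : nsext posnat) (Z : nsext int) (j : N -> Z) : Prop := {
  incl_star : forall (k : nat) (A : set (k.-tuple int)) (a : k.-tuple N),
    star Z A (map_tuple j a) <->
    star N [set t : k.-tuple posnat | A (map_tuple pint t)] a;
  incl_onto : forall z : Z,
    star Z [set t : 1.-tuple int | (0 < thead t)%R] [tuple z] <->
    exists a : N, j a = z
}.

(* Main.v *)
(* A Ramsey pair enters only through the ultrafilter [u] it generates, and [u]
   only through a dichotomy: for every [phi], either [phi x = phi y] for
   [u]-almost all [(x, y)], or almost surely [phi y] exceeds any prescribed
   function of [x].  Two functions of [(alpha, beta)] are equivalent under [~]
   iff every two-valued colouring agrees on them [u]-almost everywhere, so each
   claim needs only finitely many suitable colourings.

   For 2, 3 and 4, let [L] be the integer part of [log_2].  If [F] is between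
   [y / 2] and a power of [y] with exponent depending on [x], then
   [L (L (L F))] is [L (L (L y))] up to a bounded error, while for
   [G = x ^ y] or [G = f x * 2 ^ y] it is [L (L y)] up to a bounded error.
   Both errors are almost surely constant, so [L (L (L F))] is a function [p]
   of [L (L (L G))] with [p m < m], and a colouring alternating along the orbits
   of [p] separates [F] from [G].  A polynomial [g] which almost surely does not
   depend on [y] is first evaluated at [y] instead of [x].

   For 1, the 2-adic valuation [v2] of [x] is either almost surely shared by [x]
   and [y] or much larger for [y].  In the first case [v2 (x + y) = v2 x + 1]
   and [v2 (x * y) = 2 * v2 x] can be told apart unless [v2 x = 1], when one
   compares the distances of [x + y] and [x * y] to 4, the common value of
   [x + x] and [x * x] at [x = 2].  In the second case
   [L (x + y) = L y] and [L (x * y) = L x + L y + e], and one applies the same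
   dichotomy to [v2 (L x + e)]. *)
Require Import Defs.
From mathcomp Require Import all_boot all_order all_algebra.
From mathcomp Require Import all_classical.
From mathcomp Require Import zify.

Set Implicit Arguments.
Unset Strict Implicit.
Unset Printing Implicit Defensive.

Local Open Scope classical_set_scope.
Local Open Scope nat_scope.

(** * Transfer to the nonstandard extension *)

Lemma transfer (X : pointedType) (E : nsext X) (phi : formula X) (s : seq E) :
  (forall w, holds (@full_interp X) w phi) ->
  holds (@star X E) (nth (ns_emb E point) s) phi.
Proof.
move=> std.
(* Variables beyond [s] keep the standard default [point], so quantifying over those listed in [s]
   leaves only standard parameters. *)
have : holds (@full_interp X) (fun=> point) (foldr All phi (iota 0 (size s))).
  by apply/holds_alls => w _; exact: std.
move=> /(ns_elementary E)/holds_alls; apply => i.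
by rewrite mem_iota /= add0n -leqNgt => si; rewrite nth_default.
Qed.

(** This makes the ultrafilter of [star_fun f a] the image under [f] of that of [a]; each direction
    is a transferred statement about the graph of [f]. *)
Lemma star_preimage (X : pointedType) (E : nsext X) (k : nat)
    (f : k.-tuple X -> X) (B : set (1.-tuple X)) (a : k.-tuple E) :
  star E B [tuple star_fun f a] <-> star E [set t | B [tuple f t]] a.
Proof.
pose d := ns_emb E point; set b := star_fun f a.
pose A : set (k.-tuple X) := [set t | B [tuple f t]].
pose G : formula X := Rel (graph f) (cons_tuple 0 (iota_tuple k 1)).
pose P : formula X := Rel B [tuple 0].
pose Q : formula X := Rel A (iota_tuple k 1).
have tE (w : nat -> X) :
    graph f (map_tuple w (cons_tuple 0 (iota_tuple k 1))) ->
    B [tuple w 0] <-> A (map_tuple w (iota_tuple k 1)).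
  rewrite /graph /A /= /thead !(tnth_nth point) /= => ->.
  suff -> : behead_tuple (map_tuple w (cons_tuple 0 (iota_tuple k 1))) =
            map_tuple w (iota_tuple k 1) by [].
  exact: val_inj.
have Pw (Y : Type) (w : nat -> Y) : map_tuple w [tuple 0] = [tuple w 0].
  exact: val_inj.
have := @transfer X E (Not (And (And G P) (Not Q))) (b :: a).
have := @transfer X E (Not (And (And G Q) (Not P))) (b :: a).
have aE : map_tuple (nth d (b :: a)) (iota_tuple k 1) = a.
  apply: val_inj; rewrite /= map_nth_iota /= ?subn1 ?size_tuple // drop0.
  by rewrite take_oversize ?size_tuple.
have gE : map_tuple (nth d (b :: a)) (cons_tuple 0 (iota_tuple k 1)) =
          cons_tuple b a.
  by apply: val_inj => /=; congr cons; move/(congr1 val): aE.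
rewrite /= -/d !Pw aE gE /= => QP PQ.
have gba : star E (graph f) (cons_tuple b a) by apply/star_graphE.
split=> h; apply: contrapT => n.
- apply: PQ => // w; rewrite Pw /full_interp => -[[/tE e Bw]]; apply.
  exact/e.
- apply: QP => // w; rewrite Pw /full_interp => -[[/tE e Bw]]; apply.
  exact/e.
Qed.

Lemma star2_star1 (X : pointedType) (E : nsext X) (F : X -> X -> X)
    (f g : X -> X) (a b : E) :
  star2 F (star1 f a) (star1 g b) = star2 (fun x y => F (f x) (g y)) a b.
Proof.
set x := star1 f a; set y := star1 g b; set z := star2 F x y.
apply/star_graphE.
have -> : cons_tuple z [tuple a; b] = [tuple z; a; b] by exact: val_inj.
apply: contrapT => n.
pose G1 (h : X -> X) := graph (fun t : 1.-tuple X => h (thead t)).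
pose G2 (H : X -> X -> X) :=
  graph (fun t : 2.-tuple X => H (tnth t ord0) (tnth t ord_max)).
pose phi : formula X := Not (And (And (And
  (Rel (G1 f) [tuple 1; 3]) (Rel (G1 g) [tuple 2; 4]))
  (Rel (G2 F) [tuple 0; 1; 2]))
  (Not (Rel (G2 (fun x y => F (f x) (g y))) [tuple 0; 3; 4]))).
have := @transfer X E phi [:: z; x; y; a; b].
have m2 (Y : Type) (w : nat -> Y) i j :
    map_tuple w [tuple i; j] = [tuple w i; w j].
  exact: val_inj.
have m3 (Y : Type) (w : nat -> Y) i j k :
    map_tuple w [tuple i; j; k] = [tuple w i; w j; w k].
  exact: val_inj.
rewrite /= !m2 !m3 /=.
case=> [w|].
  rewrite !m2 !m3 /full_interp /G1 /G2 /graph /= /thead !(tnth_nth point) /=.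
  by move=> [[[-> ->] ->]].
split.
  split; first split.
  - suff -> : [tuple x; a] = cons_tuple x [tuple a] by apply/star_graphE.
    exact: val_inj.
  - suff -> : [tuple y; b] = cons_tuple y [tuple b] by apply/star_graphE.
    exact: val_inj.
  - suff -> : [tuple z; x; y] = cons_tuple z [tuple x; y] by apply/star_graphE.
    exact: val_inj.
exact: n.
Qed.

Lemma star2_swap (X : pointedType) (E : nsext X) (F : X -> X -> X) (a b : E) :
  star2 F b a = star2 (fun x y => F y x) a b.
Proof.
set z := star2 F b a; apply/star_graphE.
have -> : cons_tuple z [tuple a; b] = [tuple z; a; b] by exact: val_inj.
apply: contrapT => n.
pose G2 (H : X -> X -> X) :=
  graph (fun t : 2.-tuple X => H (tnth t ord0) (tnth t ord_max)).
pose phi : formula X := Not (And (Rel (G2 F) [tuple 0; 2; 1])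
  (Not (Rel (G2 (fun x y => F y x)) [tuple 0; 1; 2]))).
have := @transfer X E phi [:: z; a; b].
have m3 (Y : Type) (w : nat -> Y) i j k :
    map_tuple w [tuple i; j; k] = [tuple w i; w j; w k].
  exact: val_inj.
rewrite /= !m3 /=; case=> [w|].
  rewrite !m3 /full_interp /G2 /graph /= /thead !(tnth_nth point) /=.
  by move=> [->].
split; last exact: n.
suff -> : [tuple z; b; a] = cons_tuple z [tuple b; a] by apply/star_graphE.
exact: val_inj.
Qed.

(** * Almost sure statements for a Ramsey witness *)

Definition mostly (u : set_system (2.-tuple posnat))
    (P : posnat -> posnat -> Prop) : Prop :=
  u [set t | P (tnth t ord0) (tnth t ord_max)].

(* For two-valued colourings of an ultrafilter, having the same image and
   receiving almost surely the same colour are equivalent. *)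
Definition indist (u : set_system (2.-tuple posnat))
    (F G : posnat -> posnat -> nat) : Prop :=
  forall c : nat -> bool, mostly u (fun x y => c (F x y) = c (G x y)).

Section RamseyWitness.

Variable u : set_system (2.-tuple posnat).
Hypothesis u_ramsey : ramsey_witness u.

Let u_ultra : UltraFilter u. Proof. by case: u_ramsey. Qed.
Let u_filter : Filter u.
Proof. exact: (@filter_filter _ _ (@ultra_proper _ _ u_ultra)). Qed.
#[local] Existing Instance u_filter.

Implicit Types (x y : posnat) (P Q : posnat -> posnat -> Prop).
Implicit Types (phi psi : posnat -> nat).

Lemma mostlyS P Q : (forall x y, P x y -> Q x y) -> mostly u P -> mostly u Q.
Proof. by move=> PQ; apply: filterS => t; exact: PQ. Qed.

Lemma mostlyI P Q :
  mostly u P -> mostly u Q -> mostly u (fun x y => P x y /\ Q x y).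
Proof. by move=> uP uQ; apply: filterS2 uP uQ => t. Qed.

Lemma mostly_ex P : mostly u P -> exists x y, P x y.
Proof.
move=> uP; have [t Pt] := @filter_ex _ _ (@ultra_proper _ _ u_ultra) _ uP.
by exists (tnth t ord0), (tnth t ord_max).
Qed.

Lemma mostly_em P : mostly u P \/ mostly u (fun x y => ~ P x y).
Proof.
exact: (in_ultra_setVsetC [set t | P (tnth t ord0) (tnth t ord_max)] u_ultra).
Qed.

Lemma mostly_homogeneous P : mostly u P ->
  exists H : set posnat,
    infinite_set H /\ forall x y, H x -> H y -> x < y -> P x y.
Proof.
case: u_ramsey => _ /[apply] -[H [Hinf HP]]; exists H; split=> // x y Hx Hy xy.
have /HP : increasing_pairs H [tuple x; y] by exists x, y.
by [].
Qed.

Lemma infinite_above (H : set posnat) (n : nat) :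
  infinite_set H -> infinite_set (H `&` [set x : posnat | n < x]).
Proof.
move=> Hinf Hfin; apply: Hinf.
apply: (@sub_finite_set _ _ ((posnat_val @^-1` `I_n.+1) `|`
  (H `&` [set x : posnat | n < x]))).
  move=> x Hx; case: (ltnP n x) => nx; first by right.
  by left => /=; rewrite ltnS.
rewrite finite_setU; split=> //; apply: finite_preimage; last exact: finite_II.
by move=> x y _ _; exact: val_inj.
Qed.

Lemma infinite_ex_gt (H : set posnat) (n : nat) :
  infinite_set H -> exists x : posnat, H x /\ n < x.
Proof.
by move=> /(@infinite_above _ n)/infinite_setN0[x [Hx nx]]; exists x.
Qed.

(** If both alternatives fail, [phi] is injective on an infinite homogeneous set, yet at most
    [psi x0] beyond any chosen element [x0] of it. *)
Lemma mostly_dichotomy phi :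
  mostly u (fun x y => phi x = phi y) \/
  forall psi, mostly u (fun x y => psi x < phi y).
Proof.
case: (mostly_em (fun x y => phi x = phi y)) => [|phiN]; [by left|right=> psi].
case: (mostly_em (fun x y => psi x < phi y)) => // phi_le.
have [H [Hinf Hphi]] := mostly_homogeneous (mostlyI phiN phi_le).
have [x0 [Hx0 _]] := infinite_ex_gt 0 Hinf.
exfalso; have := @infinite_above _ x0 Hinf; apply.
set K := _ `&` _.
have phi_inj : {in K &, injective phi}.
  move=> x y /set_mem[Hx _] /set_mem[Hy _] xy; apply/eqP/contraT => xy_neq.
  have : val x != val y by rewrite val_eqE.
  rewrite neq_ltn => /orP[]; [case/(Hphi x y Hx Hy)|case/(Hphi y x Hy Hx)].
    by rewrite xy.
  by rewrite xy.
rewrite -(eq_finite_set (inj_card_eq phi_inj)).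
apply: (@sub_finite_set _ _ `I_(psi x0).+1); last exact: finite_II.
move=> _ [x [Hx x0x] <-] /=; rewrite ltnS leqNgt; apply/negP.
by have [] := Hphi _ _ Hx0 Hx x0x.
Qed.

Lemma mostly_lt : mostly u (fun x y => x < y).
Proof.
case: (mostly_em (fun x y => x < y)) => // /mostly_homogeneous[H [Hinf HN]].
have [x [Hx _]] := infinite_ex_gt 0 Hinf.
have [y [Hy xy]] := infinite_ex_gt x Hinf.
by case: (HN _ _ Hx Hy xy).
Qed.

Lemma mostly_gt psi : mostly u (fun x y => psi x < y).
Proof.
case: (mostly_dichotomy posnat_val) => [E|]; last exact.
have [x [y [xy]]] := mostly_ex (mostlyI mostly_lt E); lia.
Qed.

Lemma mostly_bounded phi (K : nat) :
  (forall x, phi x < K) -> mostly u (fun x y => phi x = phi y).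
Proof.
move=> phiK; case: (mostly_dichotomy phi) => // /(_ (fun=> K)) h.
have [x [y xy]] := mostly_ex h; have := phiK y; lia.
Qed.

Lemma mostly_large (K : nat) : mostly u (fun x y => K < x).
Proof.
(* Equal values of the capped, hence bounded, function together with [x < y] force [x] above [K]. *)
have h : mostly u (fun x y => minn x K.+1 = minn y K.+1).
  apply: (@mostly_bounded (fun x => minn x K.+1) K.+2) => x; lia.
by apply: mostlyS (mostlyI mostly_lt h) => x y []; lia.
Qed.

Lemma mostly_value (phi : posnat -> posnat -> nat) (K : nat) :
  mostly u (fun x y => phi x y < K) ->
  exists2 i, i < K & mostly u (fun x y => phi x y = i).
Proof.
elim: K => [|K IHK] h; first by have [x [y]] := mostly_ex h.
case: (mostly_em (fun x y => phi x y = K)) => [hK|hK]; first by exists K.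
case: IHK => [|i iK hi]; last by exists i => //; lia.
by apply: mostlyS (mostlyI h hK) => x y [] /=; lia.
Qed.

(** The residue of [r y] stays below the shared modulus, which rules out the growing alternative of
    [mostly_dichotomy]. *)
Lemma mostly_modn (r m : posnat -> nat) :
  (forall x, 0 < m x) -> mostly u (fun x y => m x = m y) ->
  mostly u (fun x y => r x = r y %[mod m x]).
Proof.
move=> m0 mE; case: (mostly_dichotomy (fun x => r x %% m x)) => [rE|].
  by apply: mostlyS (mostlyI mE rE) => x y [] mxy /= ->; rewrite mxy.
move=> /(_ m) h; have [x [y [mxy]]] := mostly_ex (mostlyI mE h).
by rewrite mxy => my; have := ltn_pmod (r y) (m0 y); lia.
Qed.

Lemma indistI F G :
  (forall c : nat -> bool,
    mostly u (fun x y => c (F x y)) -> mostly u (fun x y => c (G x y))) ->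
  indist u F G.
Proof.
move=> FG c; case: (mostly_em (fun x y => c (F x y))) => cF.
  by apply: mostlyS (mostlyI cF (FG _ cF)) => x y [-> ->].
have {}cF : mostly u (fun x y => ~~ c (F x y)).
  by apply: mostlyS cF => x y /negP.
by apply: mostlyS (mostlyI cF (FG (predC c) cF)) => x y [/negbTE -> /negbTE ->].
Qed.

(** The colour of [phi] takes two values, so it is almost surely the same at [x] and [y]. *)
Lemma indist_swap F G phi psi :
  (forall x y, F x y = phi x) -> indist u F G -> indist u (fun=> phi) G.
Proof.
move=> FE FG c.
have h : mostly u (fun x y => nat_of_bool (c (phi x)) = c (phi y)).
  by apply: (@mostly_bounded (fun x => c (phi x)) 2) => x; case: (c _).
by apply: mostlyS (mostlyI h (FG c)) => x y []; rewrite FE; do 3!case: (c _).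
Qed.

End RamseyWitness.

(** * Colourings and iterated logarithms *)

Lemma alternating_coloring (p : nat -> nat) :
  exists c : nat -> bool, forall m, p m < m -> c (p m) = ~~ c m.
Proof.
(* [k] is recursion fuel; all amounts above [m] give the same colour. *)
pose fix d k m {struct k} :=
  if k is k'.+1 then if p m < m then ~~ d k' (p m) else true else true.
have dE k k' m : m < k -> m < k' -> d k m = d k' m.
  elim: k k' m => // k IHk [|k'] // m mk mk' /=.
  by case: ifP => // pm; rewrite (IHk k') //; lia.
exists (fun m => d m.+1 m) => m pm.
by rewrite [d m.+1 m]/= pm negbK (dE _ m).
Qed.

Local Notation log := (trunc_log 2).

Lemma log_leq n k : n < 2 ^ k.+1 -> log n <= k.
Proof.
case: n => [|n nk]; first by rewrite trunc_log0.
by rewrite -ltnS -(@ltn_exp2l 2) //; apply: leq_ltn_trans nk; exact: trunc_logP.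
Qed.

Lemma log_doubleS n : log n.*2.+1 <= (log n).+1.
Proof.
by apply: log_leq; have := @trunc_log_ltn 2 n isT; rewrite [2 ^ _.+2]expnS; lia.
Qed.

Lemma log_le_doubleS m n : m <= n.*2.+1 -> log m <= (log n).+1.
Proof. by move=> /(leq_trunc_log 2)/leq_trans; apply; exact: log_doubleS. Qed.

Lemma log_sqr n : log (n ^ 2) <= (log n).*2.+1.
Proof.
apply: log_leq; have -> : (log n).*2.+2 = (log n).+1 * 2 by lia.
by rewrite expnM ltn_exp2r // trunc_log_ltn.
Qed.

Lemma loglog_sqr n : log (log (n ^ 2)) <= (log (log n)).+1.
Proof. by apply: log_le_doubleS; exact: log_sqr. Qed.

Lemma log_exp n M : log (n ^ M) <= (log n).+1 * M.
Proof.
rewrite -[leqRHS](@trunc_expnK 2) // leq_trunc_log //.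
case: M => [|M]; first by rewrite muln0.
by rewrite expnM leq_exp2r //; apply: ltnW; exact: trunc_log_ltn.
Qed.

Lemma log_ltn n : 3 < n -> (log n).+1 < n.
Proof.
move=> n3; have : 1 < log n by rewrite (@trunc_log_max 2 n 2) //; lia.
have /(@trunc_logP 2 _ isT) : 0 < n by lia.
case: (log n) => [|[|k]] // + _; suff : k.+3 < 2 ^ k.+2 by lia.
by elim: k => // k IHk; rewrite expnS; lia.
Qed.

Section Growth.

Variable u : set_system (2.-tuple posnat).
Hypothesis u_ramsey : ramsey_witness u.

Lemma indist_growth (F G : posnat -> posnat -> nat) (M : posnat -> nat) :
  indist u F G ->
  mostly u (fun x y => y <= (F x y).*2 /\ F x y <= y ^ M x) ->
  ~ mostly u (fun x y => 2 ^ y <= G x y /\ G x y <= 2 ^ (y ^ 2)).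
Proof.
move=> FG hF hG.
pose lll n := log (log (log n)).
have hlF : mostly u (fun x y => lll y <= (lll (F x y)).+1 /\
                               lll (F x y) <= (lll y).+1).
  (* For such [y], [(log y).+1 * M x] is at most [(log y) ^ 2], and the square costs at most one
     unit after two more logarithms. *)
  have hM := mostly_gt u_ramsey (fun x => 2 ^ (M x).*2).
  apply: (mostlyS u_ramsey _ (mostlyI u_ramsey hF hM)) => x y.
  move=> [[yF FM] My]; split.
    have /log_le_doubleS yF1 : y <= (F x y).*2.+1 by lia.
    have /log_le_doubleS yF2 : log y <= (log (F x y)).*2.+1 by lia.
    by apply: log_le_doubleS; lia.
  have Mlog : (M x).*2 <= log y by apply: trunc_log_max => //; exact: ltnW.
  have log_y : 0 < log y.
    by rewrite trunc_log_gt0 /=; have := expn_gt0 2 (M x).*2; lia.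
  apply: log_le_doubleS; apply: leq_trans (log_sqr _).
  apply: leq_trunc_log; apply: leq_trans (leq_trunc_log 2 FM) _.
  by apply: leq_trans (log_exp _ _) _; rewrite -mulnn; nia.
have hlG : mostly u (fun x y => log (log y) <= lll (G x y) /\
                               lll (G x y) <= (log (log y)).+1).
  apply: (mostlyS u_ramsey _ hG) => x y [yG Gy]; split.
    by do 2!apply: leq_trunc_log; exact: trunc_log_max.
  apply: leq_trans (loglog_sqr _); do 2!apply: leq_trunc_log.
  by rewrite -[leqRHS](@trunc_expnK 2) // leq_trunc_log.
(* The difference lies between -1 and 1; the successor keeps the subtraction in [nat] exact. *)
have [|i i3 hi] := @mostly_value _ u_ramsey
    (fun x y => (lll (F x y)).+1 - lll y) 3.
  by apply: (mostlyS u_ramsey _ hlF) => x y []; lia.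
have [|k k2 hk] := @mostly_value _ u_ramsey
    (fun x y => lll (G x y) - log (log y)) 2.
  by apply: (mostlyS u_ramsey _ hlG) => x y []; lia.
(* At [m = lll (G x y)], [m - k] is [log (log y)] and this map returns [lll (F x y)]. *)
have [c hc] := alternating_coloring (fun m => (log (m - k) + i).-1).
(* From 4 on, [log_ltn] absorbs the error [i - 1 <= 1], so the map decreases. *)
have hy n : mostly u (fun x y => n <= log (log y)).
  apply: (mostlyS u_ramsey _ (mostly_gt u_ramsey (fun=> 2 ^ (2 ^ n)))) => x y.
  by move=> /ltnW ny; do 2!apply: trunc_log_max => //.
have [x [y]] := mostly_ex u_ramsey (mostlyI u_ramsey (mostlyI u_ramsey
  (mostlyI u_ramsey hlF hlG) (mostlyI u_ramsey hi hk))
  (mostlyI u_ramsey (hy 4) (FG (fun n => c (lll n))))).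
move=> [[[[F1 F2] [G1 G2]] [Ei Ek]] [log_y cE]].
have GE : lll (G x y) = log (log y) + k by lia.
have FE : lll (F x y) = (log (lll (G x y) - k) + i).-1.
  by rewrite GE addnK -/(lll y); lia.
have W := log_ltn log_y; move: cE; rewrite FE hc; first by case: (c _).
by rewrite GE addnK; lia.
Qed.

End Growth.

(** * 2-adic valuations; sum against product *)

Local Notation v2 := (logn 2).

Lemma v2E d m : v2 (2 ^ d * m.*2.+1) = d.
Proof.
rewrite lognM ?expn_gt0 // pfactorK // logn_coprime ?addn0 //.
by rewrite coprime2n /= odd_double.
Qed.

Lemma v2_decomp n : 0 < n -> exists m, n = 2 ^ v2 n * m.*2.+1.
Proof.
move=> n0; have [m] := @pfactor_coprime 2 n isT n0.
rewrite coprime2n => m_odd {1}->; exists m./2.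
by rewrite mulnC -[in LHS](odd_double_half m) m_odd.
Qed.

Lemma v2_add_lt m n : 0 < m -> 0 < n -> v2 m < v2 n -> v2 (m + n) = v2 m.
Proof.
move=> /v2_decomp[p +] /v2_decomp[q +].
move: (v2 m) (v2 n) => d e -> -> de; have -> : e = d + (e - d.+1).+1 by lia.
rewrite -[RHS](v2E d (p + 2 ^ (e - d.+1) * q.*2.+1)); congr v2.
by rewrite expnD expnS -!mulnA -mulnDr; congr muln; lia.
Qed.

(** The odd cofactors agree modulo 4, so they add up to 2 modulo 4. *)
Lemma v2_add_mod m n : 0 < m -> 0 < n -> v2 m = v2 n ->
  m = n %[mod 2 ^ (v2 m).+2] -> v2 (m + n) = (v2 m).+1.
Proof.
move=> m0 n0 vE; have [p mE] := v2_decomp m0; have [q] := v2_decomp n0.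
rewrite -vE; move: (v2 m) mE => d -> ->.
rewrite (_ : 2 ^ d.+2 = 2 ^ d * 4); last by rewrite -[d.+2]addn2 expnD.
rewrite -!muln_modr => /eqP; rewrite eqn_pmul2l ?expn_gt0 // => /eqP pq.
rewrite -[RHS](v2E d.+1 (p + q)./2); congr v2.
have -> : (p + q)./2.*2.+1 = p + q + 1 by lia.
by rewrite expnS; nia.
Qed.

(** [n] and the next power of 2 are both multiples of [2 ^ k], so the gap between them exceeds
    [m]. *)
Lemma log_add k m n : m < 2 ^ k -> 2 ^ k %| n -> 0 < n -> log (m + n) = log n.
Proof.
move=> mk /dvdnP[q nE] n0; apply: trunc_log_eq => //.
have /andP[n1 n2] := @trunc_log_bounds 2 n isT n0; apply/andP; split; first lia.
have kn : k <= (log n).+1.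
  by rewrite leqW // trunc_log_max // nE leq_pmull //; case: q nE n0 => // ->.
move: (log n).+1 kn n2 => L kL; rewrite -(subnK kL) expnD nE ltn_mul2r.
move=> /andP[_ q_lt]; apply: leq_trans (leq_mul q_lt (leqnn _)).
by rewrite mulSn -addSn leq_add2r.
Qed.

Lemma log_mul m n : 0 < m -> 0 < n ->
  log m + log n <= log (m * n) <= (log m + log n).+1.
Proof.
move=> m0 n0; have /andP[m1 m2] := @trunc_log_bounds 2 m isT m0.
have /andP[n1 n2] := @trunc_log_bounds 2 n isT n0; apply/andP; split.
  by apply: trunc_log_max => //; rewrite expnD leq_mul.
apply: log_leq; rewrite -addSn -addnS expnD; exact: ltn_mul.
Qed.

Section SumProduct.

Variable u : set_system (2.-tuple posnat).
Hypothesis u_ramsey : ramsey_witness u.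

Implicit Types phi : posnat -> nat.

Lemma mostly_v2_add phi : mostly u (fun x y => 0 < phi x /\ 0 < phi y) ->
  mostly u (fun x y => v2 (phi x) = v2 (phi y)) ->
  mostly u (fun x y => v2 (phi x + phi y) = (v2 (phi x)).+1).
Proof.
move=> phi0 vE.
have m0 (x : posnat) : 0 < 2 ^ (v2 (phi x)).+2 by rewrite expn_gt0.
have mE : mostly u (fun x y => 2 ^ (v2 (phi x)).+2 = 2 ^ (v2 (phi y)).+2).
  by apply: (mostlyS u_ramsey _ vE) => x y ->.
apply: (mostlyS u_ramsey _ (mostlyI u_ramsey (mostlyI u_ramsey phi0 vE)
  (mostly_modn u_ramsey phi m0 mE))) => x y [[[x0 y0] xy]].
exact: v2_add_mod.
Qed.

(* [x + y - 4 = s] and [x * y - 4 = 2 * s + (x - 2) * (y - 2)], where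
   [s = (x - 2) + (y - 2)], so the valuations differ by one. *)
Lemma not_indist_add_mul_near2 :
  mostly u (fun x y => x %% 8 = 2 /\ y %% 8 = 2) ->
  ~ indist u (fun x y => x + y) (fun x y => x * y).
Proof.
move=> mod8 ind; pose phi (x : posnat) := x - 2.
have phi_gt0 : mostly u (fun x y => 0 < phi x /\ 0 < phi y).
  apply: (mostlyS u_ramsey _ (mostlyI u_ramsey (mostly_lt u_ramsey)
    (mostly_large u_ramsey 2))) => x y [xy]; rewrite /phi; lia.
(* This makes [2 * s] dominate [phi x * phi y]. For a shared valuation [v] it reads [v + 2 < 2 * v],
   hence the residue 2 modulo 8. *)
have H : mostly u (fun x y =>
    (v2 (phi x + phi y)).+1 < v2 (phi x) + v2 (phi y)).
  have v2_ge3 (x : posnat) : x %% 8 = 2 -> 0 < phi x -> 2 < v2 (phi x).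
    move=> x8 x0; rewrite -(@pfactor_dvdn 2 3) //; change (8 %| phi x).
    by rewrite /phi in x0 *; lia.
  case: (mostly_dichotomy u_ramsey (v2 \o phi)) => [vE|/(_ (v2 \o phi)) vlt].
    apply: (mostlyS u_ramsey _ (mostlyI u_ramsey (mostlyI u_ramsey mod8 phi_gt0)
      (mostlyI u_ramsey vE (mostly_v2_add phi_gt0 vE)))) => x y /=.
    move=> [[[x8 y8] [x0 y0]] [vxy ->]].
    by have := v2_ge3 x x8 x0; have := v2_ge3 y y8 y0; lia.
  apply: (mostlyS u_ramsey _ (mostlyI u_ramsey (mostlyI u_ramsey mod8 phi_gt0)
    vlt)) => x y /= [[[x8 y8] [x0 y0]] vxy].
  by rewrite v2_add_lt //; have := v2_ge3 y y8 y0; lia.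
have [x [y [[x0 y0] [vlt cE]]]] := mostly_ex u_ramsey (mostlyI u_ramsey phi_gt0
  (mostlyI u_ramsey H (ind (fun n => odd (v2 (n - 4)))))).
have xyD : x + y - 4 = phi x + phi y by rewrite /phi in x0 y0 *; lia.
have xyM : x * y - 4 = 2 * (phi x + phi y) + phi x * phi y.
  by rewrite /phi in x0 y0 *; nia.
have s0 : 0 < phi x + phi y by rewrite addn_gt0 x0.
have v2s : v2 (2 * (phi x + phi y)) = (v2 (phi x + phi y)).+1.
  by rewrite lognM // (pfactorK 1).
move: cE; rewrite xyD xyM [v2 (2 * _ + _)]v2_add_lt.
- by rewrite v2s /=; case: (odd _).
- by rewrite muln_gt0.
- by rewrite muln_gt0 x0.
- by rewrite v2s lognM.
Qed.

Lemma not_indist_add_mul_v2E : mostly u (fun x y => v2 x = v2 y) ->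
  ~ indist u (fun x y => x + y) (fun x y => x * y).
Proof.
move=> vE ind.
have id_gt0 : mostly u (fun x y => 0 < (x : nat) /\ 0 < (y : nat)).
  by apply: (mostlyS u_ramsey _ vE) => x y _; rewrite !posnat_gt0.
have vD := @mostly_v2_add posnat_val id_gt0 vE.
(* With [v = v2 x], the first colouring excludes [v = 0]; the second compares [v - 1] with
   [2 * (v - 1)], whose valuations differ by one if [v > 1]. *)
have v1 : mostly u (fun x y => v2 x = 1).
  apply: (mostlyS u_ramsey _ (mostlyI u_ramsey (mostlyI u_ramsey vE vD)
    (mostlyI u_ramsey (ind (fun n => v2 n == 0))
      (ind (fun n => odd (v2 (v2 n - 2))))))) => x y [[vxy ->]].
  rewrite lognM ?posnat_gt0 // -vxy addnn.
  case: (v2 x) => [[]|[|a] [_]] //; rewrite subSS subn1 /=.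
  have -> : a.+2.*2 - 2 = 2 * a.+1 by lia.
  by rewrite lognM // (pfactorK 1) //=; case: (odd _).
apply: (not_indist_add_mul_near2 _ ind).
(* A shared residue 6 or 14 gives sum 12 but product 4 modulo 16; only 2 and 10 survive, both 2
   modulo 8. *)
have mod16 : mostly u (fun x y => x %% 16 = y %% 16).
  apply: (@mostly_bounded _ u_ramsey (fun x => x %% 16) 16) => x.
  by rewrite ltn_pmod.
apply: (mostlyS u_ramsey _ (mostlyI u_ramsey (mostlyI u_ramsey v1 mod16)
  (ind (fun n => n %% 16 == 12)))) => x y [[vx xy]].
have := posnat_gt0 x => /v2_decomp[m]; rewrite vx expn1 => xE.
rewrite -(modnDm x) -(modnMm x) -xy.
have : [|| x %% 16 == 2, x %% 16 == 6, x %% 16 == 10 | x %% 16 == 14] by lia.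
by case/or4P => /eqP E; rewrite E // => _; lia.
Qed.

Lemma not_indist_add_mul_v2_lt :
  (forall psi, mostly u (fun x y => psi x < v2 y)) ->
  ~ indist u (fun x y => x + y) (fun x y => x * y).
Proof.
move=> v2_gt ind.
have [|e e2 eE] := @mostly_value _ u_ramsey
    (fun x y => log (x * y) - (log x + log y)) 2.
  apply: (mostlyS u_ramsey _ (v2_gt (fun=> 0))) => x y _.
  by have := log_mul (posnat_gt0 x) (posnat_gt0 y); lia.
pose phi (x : posnat) := log x + e.
have phi_gt0 : mostly u (fun x y => 0 < phi x /\ 0 < phi y).
  apply: (mostlyS u_ramsey _ (mostlyI u_ramsey (mostly_lt u_ramsey)
    (mostly_large u_ramsey 1))) => x y [xy x1].
  by rewrite /phi !addn_gt0 !trunc_log_gt0 /= x1 (ltn_trans x1 xy).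
have H : mostly u (fun x y => [/\ log (x + y) + e = phi y,
    log (x * y) + e = phi x + phi y, v2 (x + y) = v2 x,
    v2 (x * y) = v2 x + v2 y & v2 (phi x) < v2 y]).
  (* The summand [x] puts [x] below [2 ^ v2 y], as [log_add] requires. *)
  apply: (mostlyS u_ramsey _ (mostlyI u_ramsey eE (v2_gt (fun x =>
    x + v2 x + v2 (phi x))))) => x y [exy xy].
  rewrite lognM ?posnat_gt0 // v2_add_lt ?posnat_gt0 //; last by lia.
  rewrite (@log_add (v2 y)) ?posnat_gt0 ?pfactor_dvdnn //; last first.
    by apply: ltn_trans (ltn_expl x (isT : 1 < 2)) _; rewrite ltn_exp2l //; lia.
  have := log_mul (posnat_gt0 x) (posnat_gt0 y); rewrite /phi in xy *.
  by split=> //; lia.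
case: (mostly_dichotomy u_ramsey (v2 \o phi)) => [vE|vlt].
  have [x [y [[vxy vD] [[DE ME _ _ _] cE]]]] := mostly_ex u_ramsey
    (mostlyI u_ramsey (mostlyI u_ramsey vE (mostly_v2_add phi_gt0 vE))
      (mostlyI u_ramsey H (ind (fun n => odd (v2 (log n + e)))))).
  by move: cE; rewrite DE ME vD -[v2 (phi y)]vxy /=; case: (odd _).
(* The colour is true at the sum, as [v2 x < v2 (phi y)], and false at the product, as
   [v2 (phi x) < v2 y]. *)
have [x [y [[x0 y0] [vxy [[DE ME vD vM v_lt] cE]]]]] := mostly_ex u_ramsey
  (mostlyI u_ramsey phi_gt0 (mostlyI u_ramsey
    (vlt (fun x => v2 x + v2 (phi x)))
    (mostlyI u_ramsey H (ind (fun n => v2 n < v2 (log n + e)))))).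
move: cE; rewrite /= in vxy; rewrite DE ME vD vM v2_add_lt //; lia.
Qed.

Lemma not_indist_add_mul : ~ indist u (fun x y => x + y) (fun x y => x * y).
Proof.
case: (mostly_dichotomy u_ramsey (v2 \o posnat_val)).
  exact: not_indist_add_mul_v2E.
exact: not_indist_add_mul_v2_lt.
Qed.

End SumProduct.

(** * Polynomial growth and claims 2, 3 and 4 *)

Import GRing.Theory.

(** Induction on [q = p * 'X + c]: a nonzero integer value of [p] makes the first term at least [y]
    in absolute value, and [c] is less than half of that for large [y]. *)
Lemma poly_growth (q : {poly int}) : q != 0%R ->
  exists M : nat, forall y : nat, M < y ->
    [/\ 0 < `|q.[y%:Z]%R|, `|q.[y%:Z]%R| <= y ^ M &
        1 < size q -> y <= (`|q.[y%:Z]%R|).*2].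
Proof.
elim/poly_ind: q => [|p c IHp]; first by rewrite eqxx.
have [->|p_neq0] := eqVneq p 0%R.
  rewrite mul0r add0r polyC_eq0 => c_neq0; exists `|c|%N => y cy.
  rewrite hornerC size_polyC c_neq0; split=> //; first by rewrite absz_gt0.
  apply: leq_trans (ltnW cy) _; rewrite -[leqLHS]expn1 leq_pexp2l ?absz_gt0 //.
  exact: leq_ltn_trans cy.
have [M pM] := IHp p_neq0 => _; exists (M + `|c|.*2 + 2)%N => y My.
have [] := pM y; first lia.
rewrite hornerMXaddC; set a := (p.[_])%R => a0 aM _.
have ay : y <= `|(a * y%:Z)%R| by rewrite abszM /= leq_pmull.
have ayM : `|(a * y%:Z)%R| <= y ^ M.+1 by rewrite abszM /= expnSr leq_mul.
have yM : (y ^ M.+1).*2 <= y ^ (M + `|c|.*2 + 2).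
  have : y ^ M.+2 <= y ^ (M + `|c|.*2 + 2) by rewrite leq_pexp2l; lia.
  by apply: leq_trans; rewrite [leqRHS]expnS -mul2n leq_mul2r; lia.
by move: (a * _)%R ay ayM => b by_ byM; split=> [||_]; lia.
Qed.

Section MainCases.

Variable u : set_system (2.-tuple posnat).
Hypothesis u_ramsey : ramsey_witness u.

Lemma mostly_exp_bounds : mostly u (fun x y => 2 ^ y <= x ^ y /\
  x ^ y <= 2 ^ (y ^ 2)).
Proof.
apply: (mostlyS u_ramsey _ (mostlyI u_ramsey (mostly_lt u_ramsey)
  (mostly_large u_ramsey 1))) => x y [xy x1]; split.
  by rewrite leq_exp2r ?posnat_gt0.
apply: (@leq_trans ((2 ^ x) ^ y)).
  by rewrite leq_exp2r ?posnat_gt0 // ltnW // ltn_expl.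
by rewrite -expnM leq_pexp2l // -mulnn leq_mul2r ltnW ?orbT.
Qed.

Lemma not_indist_mul_exp : ~ indist u (fun x y => x * y) (fun x y => x ^ y).
Proof.
move=> ind; apply: (@indist_growth _ u_ramsey _ _ (fun=> 2) ind _
  mostly_exp_bounds).
apply: (mostlyS u_ramsey _ (mostly_lt u_ramsey)) => x y xy.
by have := posnat_gt0 x; split; rewrite -?mulnn; nia.
Qed.

Lemma not_indist_exp_swap : ~ indist u (fun x y => x ^ y) (fun x y => y ^ x).
Proof.
move=> ind; apply: (@indist_growth _ u_ramsey (fun x y => y ^ x) _
  (fun x => x) _ _ mostly_exp_bounds).
  by move=> c; apply: (mostlyS u_ramsey _ (ind c)) => x y ->.
apply: (mostlyS u_ramsey _ (mostly_lt u_ramsey)) => x y xy; split=> //.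
rewrite -addnn; apply: leq_trans (leq_addr _ _); rewrite -[leqLHS]expn1.
by rewrite leq_pexp2l ?posnat_gt0.
Qed.

Lemma not_indist_mul_exp2_poly (f : posnat -> posnat) (g : {poly {poly int}}) :
  ~ indist u (fun x y => f x * 2 ^ y)
             (fun x y => `|eval2 g (pint x) (pint y)|).
Proof.
move=> ind.
have hG : mostly u (fun x y => 2 ^ y <= f x * 2 ^ y /\
    f x * 2 ^ y <= 2 ^ (y ^ 2)).
  apply: (mostlyS u_ramsey _ (mostlyI u_ramsey (mostly_lt u_ramsey)
    (mostly_gt u_ramsey f))) => x y [xy fy].
  rewrite leq_pmull ?posnat_gt0 //; split=> //.
  apply: (@leq_trans (2 ^ y * 2 ^ y)).
    by rewrite leq_mul2r (ltnW (ltn_trans fy (ltn_expl y _))) ?orbT.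
  by rewrite -expnD leq_pexp2l // -mulnn; have := posnat_gt0 x; nia.
have {}ind : indist u (fun x y => `|eval2 g (pint x) (pint y)|)
    (fun x y => f x * 2 ^ y).
  by move=> c; apply: (mostlyS u_ramsey _ (ind c)) => x y ->.
pose q (x : posnat) : {poly int} := (g.[(pint x)%:P])%R.
case: (mostly_em u_ramsey (fun x y => 1 < size (q x))) => [q_gt1|q_le1].
  have /choice[M qM] (x : posnat) : exists M, forall y : posnat,
      1 < size (q x) -> M < y ->
      y <= (`|(q x).[pint y]%R|).*2 /\ `|(q x).[pint y]%R| <= y ^ M.
    have [->|/poly_growth[M qM]] := eqVneq (q x) 0%R.
      by exists 0 => y; rewrite size_poly0.
    by exists M => y q1 /qM[_ ? /(_ q1)].
  apply: (indist_growth u_ramsey (M := M) ind _ hG).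
  by apply: (mostlyS u_ramsey _ (mostlyI u_ramsey q_gt1 (mostly_gt u_ramsey M)))
    => x y [q1 My]; exact: qM.
(* [k] is [g(x, 0)], which equals [g(x, y)] wherever [q x] is constant. *)
pose k : {poly int} := map_poly (horner_eval 0%R) g.
have kE (x : posnat) : (k.[pint x] = (q x).[0])%R.
  by rewrite -[pint x in LHS](hornerC _ 0%R) -/(horner_eval 0%R _) horner_map.
have gE : mostly u (fun x y => eval2 g (pint x) (pint y) = (k.[pint x])%R).
  apply: (mostlyS u_ramsey _ q_le1) => x y /negP; rewrite -leqNgt kE => q1.
  by rewrite /eval2 -/(q x) (size1_polyC q1) !hornerC.
have {}ind : indist u (fun x y => `|(k.[pint x])%R|) (fun x y => f x * 2 ^ y).
  by move=> c; apply: (mostlyS u_ramsey _ (mostlyI u_ramsey gE (ind c)))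
    => x y [->].
have [k1|k1] := ltnP 1 (size k).
  have [|M kM] := @poly_growth k; first by rewrite -size_poly_gt0 ltnW.
  apply: (@indist_growth _ u_ramsey (fun x y => `|(k.[pint y])%R|) _
    (fun=> M) _ _ hG).
    exact: (@indist_swap _ u_ramsey _ _ (fun x => `|(k.[pint x])%R|)).
  apply: (mostlyS u_ramsey _ (mostly_gt u_ramsey (fun=> M))) => x y My.
  by have [_ ? /(_ k1)] := kM y My.
(* If [k] is constant too, its colour class forces [f x * 2 ^ y] to be a fixed number, below [y]. *)
have [x [y [[y_lt [G_ge _]]]]] := mostly_ex u_ramsey
  (mostlyI u_ramsey
    (mostlyI u_ramsey (mostly_gt u_ramsey (fun=> `|(k`_0)%R|)) hG)
    (ind (pred1 `|(k`_0)%R|))).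
rewrite /= [X in X.[_]%R](size1_polyC k1) hornerC eqxx => /esym/eqP E.
rewrite E in G_ge.
have := ltn_trans (ltn_expl y (isT : 1 < 2)) (leq_ltn_trans G_ge y_lt).
by rewrite ltnn.
Qed.

End MainCases.

(** * From equivalence of nonstandard numbers to colourings *)

Lemma ueq1_indist (E : nsext posnat) (a b : E)
    (F G : posnat -> posnat -> posnat) :
  ramsey_pair a b -> ueq1 (star2 F a b) (star2 G a b) ->
  indist (ultra [tuple a; b]) (fun x y => F x y) (fun x y => G x y).
Proof.
move=> ab_ramsey FG; apply: (indistI ab_ramsey) => c cF.
pose B : set (1.-tuple posnat) := [set t : 1.-tuple posnat | c (thead t)].
have : ultra [tuple star2 F a b] B by apply/star_preimage; exact: cF.
by rewrite FG => /star_preimage.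
Qed.

Lemma ueq1_incl_indist (N : nsext posnat) (Z : nsext int) (j : N -> Z)
    (a b : N) (F : posnat -> posnat -> posnat) (g : {poly {poly int}}) :
  star_inclusion j -> ramsey_pair a b ->
  ueq1 (j (star2 F a b)) (star2 (eval2 g) (j a) (j b)) ->
  indist (ultra [tuple a; b]) (fun x y => F x y)
    (fun x y => `|eval2 g (pint x) (pint y)|).
Proof.
move=> hj ab_ramsey Fg; apply: (indistI ab_ramsey) => c cF.
(* Integers are coloured through the absolute value, which fixes the positive ones. *)
pose B : set (1.-tuple int) := [set t : 1.-tuple int | c `|thead t|].
have map1 (x : N) : map_tuple j [tuple x] = [tuple j x] by exact: val_inj.
have map2 (x y : N) : map_tuple j [tuple x; y] = [tuple j x; j y].
  exact: val_inj.
have : ultra [tuple j (star2 F a b)] B.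
  by rewrite /ultra /= -map1; apply/(incl_star hj)/star_preimage; exact: cF.
rewrite Fg => /star_preimage; rewrite -map2 => /(incl_star hj).
rewrite /mostly /ultra /=; congr (star N _ _); apply/funext => t /=.
by rewrite !tnth_map.
Qed.

Theorem theoremA (N : nsext posnat) (Z : nsext int) (j : N -> Z)
    (hj : star_inclusion j) (alpha beta : N) (hR : ramsey_pair alpha beta) :
  [/\ ~ ueq1 (star2 paddn alpha beta) (star2 pmuln alpha beta),
      ~ ueq1 (star2 pmuln alpha beta) (star2 pexpn alpha beta),
      ~ ueq1 (star2 pexpn alpha beta) (star2 pexpn beta alpha) &
      forall (f : posnat -> posnat) (g : {poly {poly int}}),
        ~ ueq1 (j (star2 pmuln (star1 f alpha) (star1 (pexpn ptwo) beta)))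
               (star2 (eval2 g) (j alpha) (j beta))].
Proof.
split=> [||| f g].
- by move=> /(ueq1_indist hR); exact: not_indist_add_mul.
- by move=> /(ueq1_indist hR); exact: not_indist_mul_exp.
- have -> : star2 pexpn beta alpha = star2 (fun x y => pexpn y x) alpha beta.
    exact: star2_swap.
  by move=> /(ueq1_indist hR); exact: not_indist_exp_swap.
- rewrite star2_star1 => /(ueq1_incl_indist hj hR).
  exact: not_indist_mul_exp2_poly.
Qed.
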